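(* Let $f:X\to\overline{\mathbb{R}}$ be a proper convex function, let $T$ be an arbitrary index set and let $h_t:X\to\overline{\mathbb{R}}$, $t\in T$, be proper convex functions. Set $$\mathcal{B}=\bigcap_{\lambda\in\mathbb{R}^{(T)}_+}\{x\in X:(\operatorname{econv}\lambda h)(x)\le 0\},\qquad K=\bigcup_{\lambda\in\mathbb{R}^{(T)}_+}\operatorname{epi}(\lambda h)^c .$$ Suppose that $f$ and $\delta_{\mathcal{B}}$ satisfy the additivity condition $\operatorname{econv}(f+\delta_{\mathcal{B}})=\sup\{a:a\in\widetilde{\mathcal{E}}_{f,\delta_{\mathcal{B}}}\}$ and that $K$ is e$'$-convex. Then the following statements are equivalent: (i) $\operatorname{epi} f^c+K$ is e$'$-convex; (ii) for every $(x^*,y^*,\alpha)\in W$, $$(f+\delta_{\mathcal{B}})^c(x^*,y^*,\alpha)=\min_{\lambda\in\mathbb{R}^{(T)}_+}\ \min_{(u^*,v^*,\gamma)\in W}\{f^c(u^*,v^*,\gamma)+(\lambda h)^c(x^*-u^*,y^*-v^*,\alpha-\gamma)\}$$ (with both minima attained); (iii) for all $\overline{x}\in\mathcal{B}\cap\operatorname{dom} f$ and $\varepsilon\ge0$, $$\partial_{c,\varepsilon}(f+\delta_{\mathcal{B}})(\overline{x})=\bigcup_{\lambda\in\mathbb{R}^{(T)}_+}\ \bigcup_{\substack{\varepsilon_1\ge0,\ \varepsilon_2\ge0\\ \varepsilon_1+\varepsilon_2=\varepsilon+(\operatorname{econv}\lambda h)(\overline{x})}}\{\partial_{c,\varepsilon_1}f(\overline{x})+\partial_{c,\varepsilon_2}(\operatorname{econv}\lambda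 h)(\overline{x})\}.$$
   Context: $X$ is a non-trivial separated (Hausdorff) locally convex space whose topology is the one induced by its continuous dual $X^*$; $\langle x,x^*\rangle$ is the value of $x^*\in X^*$ at $x\in X$; $\overline{\mathbb{R}}=\mathbb{R}\cup\{\pm\infty\}$. The sign convention gives priority to $-\infty$: $(+\infty)+(-\infty)=(-\infty)+(+\infty)=(+\infty)-(+\infty)=(-\infty)-(-\infty)=-\infty$. For $f:X\to\overline{\mathbb{R}}$, $\operatorname{dom} f=\{x:f(x)<+\infty\}$ and $\operatorname{epi} f=\{(x,\alpha)\in X\times\mathbb{R}:f(x)\le\alpha\}$ (and likewise for functions on other spaces); $f$ is proper if it never takes the value $-\infty$ and $\operatorname{dom} f\ne\emptyset$. The indicator function is $\delta_D(x)=0$ if $x\in D$ and $+\infty$ otherwise. A set $C$ in a locally convex space is e-convex if it is an intersection of an arbitrary family of open half-spaces (equivalently, for every $x_0\notin C$ there is a continuous linear functional $x^*$ with $\langle x-x_0,x^*\rangle<0$ for all $x\in C$). A function is e-convex if its epigraph is e-convex. $\operatorname{econv} f$ is the largest e-convex minorant of $f$. A function $a:X\to\overline{\mathbb{R}}$ is e-affine if there are $x^*,y^*\in X^*$, $\alpha,\beta\in\mathbb{R}$ with $a(x)=\langle x,x^*\rangle-\beta$ if $\langle x,y^*\rangle<\alpha$ and $a(x)=+\infty$ otherwise. $\mathcal{E}_f$ is the set of all e-affine functions $a$ with $a\le f$. For $f_1,f_2:X\to\overline{\mathbb{R}}$, an e-affine function $a$ belongs to $\widetilde{\mathcal{E}}_{f_1,f_2}$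 if there exist $a_i\in\mathcal{E}_{f_i}$, $a_i(x)=\langle x,x_i^*\rangle-\beta_i$ if $\langle x,y_i^*\rangle<\alpha_i$ and $+\infty$ otherwise ($i=1,2$), such that $a(x)=\langle x,x_1^*+x_2^*\rangle-(\beta_1+\beta_2)$ if $\langle x,y_1^*+y_2^*\rangle<\alpha_1+\alpha_2$ and $a(x)=+\infty$ otherwise. The additivity condition is formulated for proper functions $f_1,f_2$ (here $f$ and $\delta_{\mathcal{B}}$). $W:=X^*\times X^*\times\mathbb{R}$. The coupling functions are $c:X\times W\to\overline{\mathbb{R}}$, $c(x,(x^*,y^*,\alpha))=\langle x,x^*\rangle$ if $\langle x,y^*\rangle<\alpha$ and $+\infty$ otherwise, and $c'((x^*,y^*,\alpha),x)=c(x,(x^*,y^*,\alpha))$. The $c$-conjugate of $f:X\to\overline{\mathbb{R}}$ is $f^c:W\to\overline{\mathbb{R}}$, $f^c(w)=\sup_{x\in X}\{c(x,w)-f(x)\}$. A $c'$-elementary function is a function $c'(\cdot,x)-\beta:W\to\overline{\mathbb{R}}$ with $x\in X$, $\beta\in\mathbb{R}$. A function $W\to\overline{\mathbb{R}}$ is e$'$-convex if it is the pointwise supremum of a set of $c'$-elementary functions. A set $D\subseteq W\times\mathbb{R}$ is e$'$-convex if $D=\operatorname{epi}k$ for some e$'$-convex function $k:W\to\overline{\mathbb{R}}$. Sums of sets are Minkowski sums. For $f:X\to\overline{\mathbb{R}}$, $\varepsilon\ge0$ and $\overline{x}$ with $f(\overline{x})\in\mathbb{R}$, $\partial_{c,\varepsilon}f(\overline{x})$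 is the set of $(x^*,y^*,\alpha)\in W$ such that $\langle\overline{x},y^*\rangle<\alpha$ and $f(x)-f(\overline{x})\ge c(x,(x^*,y^*,\alpha))-c(\overline{x},(x^*,y^*,\alpha))-\varepsilon$ for all $x\in X$; if $f(\overline{x})\notin\mathbb{R}$, $\partial_{c,\varepsilon}f(\overline{x})=\emptyset$. $\mathbb{R}^{(T)}$ is the space of families $\lambda=(\lambda_t)_{t\in T}$ of reals with only finitely many nonzero entries, $\mathbb{R}^{(T)}_+$ the subset of those with all $\lambda_t\ge0$, and $\lambda h:=\sum_{t\in T}\lambda_t h_t$ (the finite sum over those $t$ with $\lambda_t\neq0$).
   Formalization: It is assumed in addition that B ∩ dom f is nonempty and that, for every λ in R^(T)_+, econv(λh) is either nowhere −∞ or identically −∞; without either assumption the stated equivalence can fail. *)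

(* Defs.v *)
From HB Require Import structures.
From mathcomp Require Import all_boot all_order all_algebra finmap.
From mathcomp Require Import all_classical all_reals all_analysis.

Set Implicit Arguments.
Unset Strict Implicit.
Unset Printing Implicit Defensive.

Import Order.TTheory GRing.Theory Num.Theory.
Import numFieldNormedType.Exports.

Local Open Scope classical_set_scope.
Local Open Scope ring_scope.
Local Open Scope ereal_scope.

(* The addition of \bar R gives priority to -oo, so all four indeterminate
   sums and differences of infinities are -oo, as the theory requires. *)

Section TopologicalDual.
Context {R : realType} (E : tvsType R).

Definition dual_pred : {pred E -> R^o} :=
  fun u => `[< linear u /\ continuous u >].

Lemma dual_submod_closed : submod_closed dual_pred.
Proof.
have lin0 : linear (0%R : E -> R^o).
  by move=> b x y; rewrite (_ : (0%R : E -> R^o) = fun=> 0%R)// scaler0 addr0.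
split=> [|a u v /asboolP[lu cu] /asboolP[lv cv]]; apply/asboolP; split => //.
- by move=> x; exact: cvg_cst.
- move=> b x y; rewrite -[LHS]/(a *: u _ + v _)%R lu lv.
  rewrite -[X in _ = (b *: X + _)%R]/(a *: u x + v x)%R.
  rewrite -[X in _ = (_ + X)%R]/(a *: u y + v y)%R.
  by rewrite !scalerDr !scalerA (mulrC a) addrACA.
- move=> x; apply: (@cvgD _ _ _ _ _ (a *: u)%R v _ _ _ (cv x)).
  exact: (@cvgZl_tmp R R^o E (nbhs x) _ a u _ (cu x)).
Qed.

HB.instance Definition _ :=
  GRing.isSubmodClosed.Build R (E -> R^o) dual_pred dual_submod_closed.

Record topdual := TopDual { dual_fun :> E -> R^o; _ : dual_fun \in dual_pred }.

HB.instance Definition _ := [isSub for dual_fun].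
HB.instance Definition _ := [Choice of topdual by <:].
HB.instance Definition _ := [SubChoice_isSubLmodule of topdual by <:].

Definition has_weak_topology : Prop :=
  forall U : set E, open U <->
    @open (sup_topology (fun u : topdual =>
             Topological.class (initial_topology (u : E -> R^o)))) U.

Definition open_halfspace (H : set E) : Prop :=
  exists (u : topdual) (a : R), u != 0%R /\ H = [set x | (u x < a)%R].

Definition e_convex_set (C : set E) : Prop :=
  exists2 F : set (set E), F `<=` open_halfspace & C = \bigcap_(H in F) H.

End TopologicalDual.

Definition minkowski_sum {V : zmodType} (A B : set V) : set V :=
  [set (a + b)%R | a in A & b in B].

Definition is_min {R : realType} (A : set (\bar R)) (m : \bar R) : Prop :=
  A m /\ lbound A m.

Definition fsupp (R : realType) (T : choiceType) : Type :=
  {fsfun T -> R with 0%R}.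

Definition fsupp_ge0 (R : realType) (T : choiceType) : set (fsupp R T) :=
  [set lam | forall t, (0 <= lam t)%R].
Arguments fsupp_ge0 : clear implicits.

Section ExtendedRealFunctions.
Context {R : realType}.

Definition edom {Y : Type} (g : Y -> \bar R) : set Y := [set y | g y < +oo].

Definition epi {Y : Type} (g : Y -> \bar R) : set (Y * R^o) :=
  [set p | g p.1 <= p.2%:E].

Definition proper_fun {Y : Type} (g : Y -> \bar R) : Prop :=
  (forall y, g y != -oo) /\ edom g !=set0.

Definition delta_fun {Y : Type} (D : set Y) (y : Y) : \bar R :=
  if y \in D then 0 else +oo.

Definition wsum (T : choiceType) {Y : Type} (lam : fsupp R T)
    (h : T -> Y -> \bar R) (y : Y) : \bar R :=
  \sum_(t <- finsupp lam) (lam t)%:E * h t y.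

End ExtendedRealFunctions.

Section EvenlyConvex.
Context {R : realType} (X : tvsType R).
Implicit Types (f g a : X -> \bar R).

Definition convex_fun f : Prop := convex_set (epi f : set (X * R^o)%type).

Definition e_convex_fun f : Prop := e_convex_set (epi f : set (X * R^o)%type).

Definition econv f (x : X) : \bar R :=
  ereal_sup [set g x | g in [set g | e_convex_fun g /\ forall z, g z <= f z]].

Definition W : Type := (topdual X * topdual X * R^o)%type.

Definition coupling (x : X) (w : W) : \bar R :=
  if (w.1.2 x < w.2)%R then (w.1.1 x)%:E else +oo.

Definition coupling' (w : W) (x : X) : \bar R := coupling x w.

Definition c_conj f (w : W) : \bar R :=
  ereal_sup [set coupling x w - f x | x in [set: X]].

Definition c'_elementary (k : W -> \bar R) : Prop :=
  exists (x : X) (b : R), k = fun w => coupling' w x - b%:E.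

(* The empty supremum is allowed; it is the constant -oo. *)
Definition e'_convex_fun (k : W -> \bar R) : Prop :=
  exists2 S : set (W -> \bar R), S `<=` c'_elementary &
    k = fun w => ereal_sup [set e w | e in S].

Definition e'_convex_set (D : set (W * R^o)) : Prop :=
  exists2 k : W -> \bar R, e'_convex_fun k & D = epi k.

Definition e_affine (u v : topdual X) (al be : R) (x : X) : \bar R :=
  if (v x < al)%R then (u x - be)%:E else +oo.

Definition e_minorants f : set (X -> \bar R) :=
  [set a | (exists u v al be, a = e_affine u v al be) /\
           forall x, a x <= f x].

Definition e_minorants_sum f1 f2 : set (X -> \bar R) :=
  [set a | exists (u1 v1 u2 v2 : topdual X) (al1 be1 al2 be2 : R),
     [/\ e_minorants f1 (e_affine u1 v1 al1 be1),
         e_minorants f2 (e_affine u2 v2 al2 be2) &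
         a = e_affine (u1 + u2)%R (v1 + v2)%R (al1 + al2)%R (be1 + be2)%R]].

Definition additivity_condition f1 f2 : Prop :=
  [/\ proper_fun f1, proper_fun f2 &
      forall x, econv (fun z => f1 z + f2 z) x =
                ereal_sup [set a x | a in e_minorants_sum f1 f2]].

Definition c_subdiff (eps : R) f (xbar : X) : set W :=
  [set w : W | [/\ f xbar \is a fin_num, (w.1.2 xbar < w.2)%R &
     forall x, coupling x w - coupling xbar w - eps%:E <= f x - f xbar]].

Section ConstraintSystem.
Context {T : choiceType} (h : T -> X -> \bar R).

Definition econv_feasible : set X :=
  \bigcap_(lam in fsupp_ge0 R T) [set x | econv (wsum lam h) x <= 0].

Definition moment_set : set (W * R^o) :=
  \bigcup_(lam in fsupp_ge0 R T) epi (c_conj (wsum lam h)).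

End ConstraintSystem.

Lemma econv_le f x : econv f x <= f x.
Proof. by apply: ge_ereal_sup => _ [g [_ gf] <-]. Qed.

Lemma econv_max f g :
  e_convex_fun g -> (forall z, g z <= f z) -> forall x, g x <= econv f x.
Proof. by move=> eg gf x; apply: ereal_sup_ubound; exists g. Qed.

Lemma e_convex_econv f : e_convex_fun (econv f).
Proof.
pose M := [set g | e_convex_fun g /\ forall z, g z <= f z].
exists [set H | open_halfspace H /\ exists2 g, M g & epi g `<=` H].
  by move=> H [].
apply/seteqP; split=> [p pf H [_ [g Mg]]|p pF].
  apply; apply: (le_trans _ pf).
  by case: Mg => eg gf; exact: econv_max.
apply: ge_ereal_sup => _ [g Mg <-].
have [[F Fh gE] _] := Mg; suff: epi g p by [].
by rewrite gE => H FH; apply: pF; split; [exact: Fh|exists g => // q; rewrite gE; exact].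
Qed.

End EvenlyConvex.

(* Main.v *)
Require Import Defs.
From HB Require Import structures.
From mathcomp Require Import all_boot all_order all_algebra finmap.
From mathcomp Require Import all_classical all_reals all_analysis.
From mathcomp Require Import lra.

Import Order.TTheory GRing.Theory Num.Theory.
Import numFieldNormedType.Exports.

Local Open Scope classical_set_scope.
Local Open Scope ring_scope.
Local Open Scope ereal_scope.

(** The proof rests on one polarity between primal pairs (x, b) in X * R and
    dual pairs (w, t) in W * R: they are related when the e-affine function
    c(., w) - t is at most b at x, that is when c(x, w) <= b + t.  Three facts
    put all the objects of the theorem inside this Galois connection.

    - The epigraph of a c-conjugate is the dual polar of the epigraph of the
      function ([epi_c_conj]), and a set is e'-convex exactly when it is its own
      bipolar ([e'_convex_setP]).
    - A function and its e-convex hull have the same e-affine minorants, and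
      unless the hull takes both the value -oo and some other value, it is the
      supremum of those minorants ([epi_econv]).  Separation comes for free
      here, since e-convexity provides the half-spaces: a non-vertical one gives
      a continuous affine minorant, a vertical one cuts the domain of an affine
      minorant obtained elsewhere.
    - The primal polar of K is the epigraph of the indicator of the feasible set
      B ([primal_polar_moment_set]): K is stable under the scaling that comes
      from multiplying the coefficients lambda, which forces each minorant of
      lambda h to be nonpositive at a point of the polar.

    Since K is e'-convex, it follows that K is the epigraph of the conjugate of
    the indicator of B.  The additivity condition says that the hull of
    f + delta_B is the function whose epigraph is the primal polar of
    M = epi f^c + K, so epi (f + delta_B)^c is the bipolar of M, and (i) says
    exactly that M = epi (f + delta_B)^c.

    Both (ii) and (iii) are rewritings of that equality of sets.  For (ii), an
    infimal convolution is exact with value G if and only if the sum of the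
    epigraphs is epi G ([exact_inf_convolutionP]).  For (iii), w is an
    eps-subgradient of g at x if and only if (w, <x, w> + eps - g x) belongs to
    epi g^c ([c_subdiffP]), so that the two sides of (iii) are the sections of
    epi (f + delta_B)^c and of M by such points; the constraints on eps1 and
    eps2 are instances of the Fenchel-Young inequality ([c_subdiff_sum]).
    Sections at one feasible point x already see the whole epigraph, as any pair
    (w, t) in it has the above form for eps = t - <x, w> + f x, which is
    nonnegative by the same inequality. *)

(** * Functionals on the product with the real line *)

Lemma topdual_linear {R : realType} {E : tvsType R} (u : topdual E) :
  linear (u : E -> R^o).
Proof. by case: u => u /= /asboolP[]. Qed.

Lemma topdual_continuous {R : realType} {E : tvsType R} (u : topdual E) :
  continuous (u : E -> R^o).
Proof. by case: u => u /= /asboolP[]. Qed.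

Lemma topdual0E {R : realType} {E : tvsType R} (x : E) :
  (0%R : topdual E) x = 0%R.
Proof. by []. Qed.

Section ProductDual.
Context {R : realType} {X : tvsType R}.

Lemma pair_dual_subproof (v : topdual X) (s : R) :
  (fun p : X * R^o => (v p.1 + s * p.2)%R : R^o) \in @dual_pred R (X * R^o)%type.
Proof.
apply/asboolP; split.
  move=> b p q; rewrite /= (topdual_linear v) mulrDr mulrCA scalerDr.
  by rewrite addrACA.
move=> p; apply: (@cvgD _ R^o).
  apply: (@continuous_comp _ _ _ fst v); first exact: cvg_fst.
  exact: topdual_continuous.
apply: (@continuous_comp _ _ _ snd (fun t : R^o => s * t : R^o)%R).
  exact: cvg_snd.
exact: mulrl_continuous.
Qed.

Definition pair_dual v s : topdual (X * R^o)%type :=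
  TopDual (pair_dual_subproof v s).

Lemma fst_dual_subproof (u : topdual (X * R^o)%type) :
  (fun x : X => u (x, 0%R)) \in @dual_pred R X.
Proof.
apply/asboolP; split.
  move=> b x y; rewrite -(topdual_linear u); congr (u _).
  by congr (_, _); rewrite /= scaler0 addr0.
move=> x; apply: (@continuous_comp _ _ _ (fun x : X => (x, 0%R : R^o)) u).
  exact: (cvg_pair cvg_id (cvg_cst _)).
exact: topdual_continuous.
Qed.

Definition fst_dual u : topdual X := TopDual (fst_dual_subproof u).

Lemma topdual_prodE (u : topdual (X * R^o)%type) p :
  u p = (fst_dual u p.1 + p.2 * u (0, 1))%R.
Proof.
rewrite [RHS]addrC -[RHS](topdual_linear u); case: p => x t /=.
congr (u _); congr (_, _); rewrite /=; first by rewrite scaler0 add0r.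
by rewrite addr0 /GRing.scale /= mulr1.
Qed.

(** The separating functional may be zero, which happens only when C is empty;
    a nonzero functional exists on the product because of its real factor. *)
Lemma e_convex_setP (C : set (X * R^o)%type) :
  e_convex_set C <->
  forall p, ~ C p -> exists u : topdual (X * R^o)%type,
    forall q, C q -> (u q < u p)%R.
Proof.
split=> [[F Fh CE] p|sep].
  rewrite CE => /existsNP[H /not_implyP[FH Hp]].
  have [u [a [_ HE]]] := Fh _ FH; exists u => q /(_ _ FH).
  by move: Hp; rewrite HE /= => /negP; rewrite -leNgt => /[swap]; exact: lt_le_trans.
exists [set H | open_halfspace H /\ C `<=` H]; first by move=> H [].
apply/seteqP; split=> [p Cp H [_]|p pC]; first exact.
apply: contrapT => nCp; have [u up] := sep p nCp.
pose u' := if u == 0%R then pair_dual 0%R 1%R else u.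
have : [set q | (u' q < u' p)%R] p.
  apply: pC; split.
    exists u', (u' p); split=> //; rewrite /u'; case: ifPn => // _.
    apply/eqP => u0; have /eqP : (0 + 1 * 1 = 0 :> R)%R.
      exact: (congr1 (fun w : topdual (X * R^o)%type => w (0, 1)%R) u0).
    by rewrite mulr1 add0r oner_eq0.
  by move=> q /up; rewrite /u' /=; case: ifPn => // /eqP->; rewrite !topdual0E ltxx.
by rewrite /= ltxx.
Qed.

End ProductDual.

(** * Polarity between primal and dual epigraphs *)

Section Polarity.
Set Implicit Arguments.
Unset Strict Implicit.
Context {R : realType} {X : tvsType R}.
Implicit Types (f g : X -> \bar R) (p : X * R^o) (q : W X * R^o)
  (A : set (X * R^o)) (D : set (W X * R^o)).

(** The pair (w, t) encodes the e-affine function c(., w) - t; with this choice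
    the e-affine minorants of g are the points of epi g^c, with addition of
    minorants being addition in W * R. *)
Definition affine_of q : X -> \bar R :=
  e_affine q.1.1.1 q.1.1.2 q.1.2 q.2.

Definition dual_polar A : set (W X * R^o) :=
  [set q | A `<=` epi (affine_of q)].

Definition primal_polar D : set (X * R^o) :=
  [set p | forall q, D q -> epi (affine_of q) p].

Lemma epi_affine_of p q : epi (affine_of q) p <->
  (q.1.1.2 p.1 < q.1.2)%R /\ (q.1.1.1 p.1 <= p.2 + q.2)%R.
Proof.
rewrite /epi /affine_of /e_affine /=; case: ifP => _; last by split=> // -[].
by rewrite lee_fin lerBlDr; split=> // -[].
Qed.

Lemma affine_ofE q x : affine_of q x = coupling x q.1 - q.2%:E.
Proof. by rewrite /affine_of /e_affine /coupling; case: ifP. Qed.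

(** With the convention that -oo absorbs +oo, no finiteness of a or y is needed
    to exchange y and a real t, although addition of infinities cannot be
    cancelled. *)
Lemma leeB_swap (a y : \bar R) (t : R) :
  (a - y <= t%:E) = (a - t%:E <= y).
Proof.
case: a y => [a| |] [y| |] //=; rewrite ?leey ?leNye// !lee_fin.
by rewrite !lerBlDr addrC.
Qed.

Lemma epi_subset {Y : Type} (a g : Y -> \bar R) :
  (forall y, a y <= g y) <-> epi g `<=` epi a.
Proof.
split=> [ag p|sub y]; first exact: le_trans.
have {}sub (r : R) : g y <= r%:E -> a y <= r%:E by exact: (sub (y, r)).
case: (g y) sub => [r| |] sub; [exact: sub|by rewrite leey|].
have {}sub (r : R) : a y <= r%:E by apply: sub; rewrite leNye.
case: (a y) sub => [r| |] // sub; last by have := sub 0%R.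
by have := sub (r - 1)%R; rewrite lee_fin lerBrDr gerDl ler10.
Qed.

Lemma epi_inj {Y : Type} : injective (@epi R Y).
Proof.
move=> a g ag; apply/funext => y; apply/le_anti/andP.
by split; move: y; apply/epi_subset; rewrite ag.
Qed.

(** By [leeB_swap], c(x, w) - g x <= t for all x amounts to
    c(., w) - t <= g. *)
Lemma epi_c_conj g : epi (c_conj g) = dual_polar (epi g).
Proof.
apply/seteqP; split=> q qg.
  apply/epi_subset => x; rewrite affine_ofE -leeB_swap.
  by apply: le_trans qg; apply: ereal_sup_ubound; exists x.
apply: ge_ereal_sup => _ [x _ <-]; rewrite leeB_swap -affine_ofE.
by move: x; apply/epi_subset.
Qed.

Lemma dual_polarS A B : A `<=` B -> dual_polar B `<=` dual_polar A.
Proof. by move=> AB q Bq p /AB; exact: Bq. Qed.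

(** The c'-elementary functions are the w |-> c(x, w) - b, so an e'-convex set
    consists of the (w, t) that are polar to a family of pairs (x, b). *)
Lemma e'_convex_setP D :
  e'_convex_set D <-> D = dual_polar (primal_polar D).
Proof.
split=> [[k [S Sc kE] DE]|DE].
  apply/seteqP; split=> [q Dq p|q qD]; first exact.
  rewrite DE /epi /= kE; apply: ge_ereal_sup => _ [e Se <-].
  have [x [b eE]] := Sc _ Se; rewrite eE /coupling' leeB_swap -affine_ofE.
  apply: (qD (x, b)) => q'; rewrite DE => q'k.
  rewrite /epi /= affine_ofE -leeB_swap; apply: le_trans q'k.
  by rewrite kE; apply: ereal_sup_ubound; exists e => //; rewrite eE.
pose elt (p : X * R^o) w : \bar R := coupling' w p.1 - p.2%:E.
exists (fun w => ereal_sup [set e w | e in elt @` primal_polar D]).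
  by exists (elt @` primal_polar D) => // _ [p _ <-]; exists p.1, p.2.
rewrite [LHS]DE; apply/seteqP; split=> q qD.
  apply: ge_ereal_sup => _ [_ [p pD <-] <-].
  by rewrite /elt leeB_swap -affine_ofE; exact: qD.
move=> p pD; rewrite /epi /= affine_ofE -leeB_swap; apply: le_trans qD.
by apply: ereal_sup_ubound; exists (elt p) => //; exists p.
Qed.

Lemma e_convex_affine_of q : e_convex_fun (affine_of q).
Proof.
apply/e_convex_setP => p; rewrite epi_affine_of => np.
have [vp|vp] := ltP (q.1.1.2 p.1) q.1.2.
  exists (pair_dual q.1.1.1 (-1)%R) => p' /epi_affine_of[_ up'] /=.
  have /negP : ~ (q.1.1.1 p.1 <= p.2 + q.2)%R by move=> up; exact: np.
  rewrite -ltNge !mulN1r; lra.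
exists (pair_dual q.1.1.2 0%R) => p' /epi_affine_of[vp' _] /=.
by rewrite !mul0r !addr0; exact: lt_le_trans vp.
Qed.

(** E-affine functions are e-convex, hence those below g are below its
    e-convex hull. *)
Lemma dual_polar_econv g : dual_polar (epi (econv g)) = dual_polar (epi g).
Proof.
apply/seteqP; split; first by apply: dual_polarS; apply/epi_subset/econv_le.
move=> q /epi_subset qg; apply/epi_subset; apply: econv_max => //.
exact: e_convex_affine_of.
Qed.

Lemma c_conj_econv g : c_conj (econv g) = c_conj g.
Proof. by apply: epi_inj; rewrite !epi_c_conj dual_polar_econv. Qed.

(** A half-space that is not vertical is bounded by the graph of a continuous
    affine function; the cutting inequality 0 < 1 makes that function e-affine
    with full domain. *)
Lemma nonvertical_minorant g (u : topdual (X * R^o)%type) p :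
  (u (0, 1)%R < 0)%R -> (forall p', epi g p' -> (u p' < u p)%R) ->
  let v := ((- u (0, 1))^-1 *: fst_dual u)%R in
  dual_polar (epi g) (v, 0%R, 1%R, (v p.1 - p.2)%R).
Proof.
set s := u (0, 1)%R => s0 up v p' /up.
rewrite (topdual_prodE u p') (topdual_prodE u p) -/s => pp'.
set k := ((- s)^-1)%R in v *; have k0 : (0 < k)%R by rewrite invr_gt0 oppr_gt0.
have ks : (k * s = - 1)%R by rewrite /k invrN mulNr mulVf ?lt_eqF.
have vE x : v x = (k * fst_dual u x)%R by [].
clearbody v; apply/epi_affine_of; split=> /=; first exact: ltr01.
rewrite !vE.
move: pp'; rewrite -(ltr_pM2l k0) !mulrDr !(mulrCA k) ks; lra.
Qed.

(** A point p outside epi g is separated from it by some u.  If u is not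
    vertical it yields an affine minorant of g that exceeds p; if it is
    vertical, restricting some affine minorant of g to the open half-space given
    by u yields an e-affine minorant that is +oo at p.  An affine minorant to
    restrict exists because g avoids -oo: at a point where g is finite, a
    half-space that contains the epigraph and excludes a point below the graph
    cannot be vertical. *)
Lemma e_convex_bipolar g : e_convex_fun g -> (forall x, g x != -oo) ->
  primal_polar (dual_polar (epi g)) `<=` epi g.
Proof.
move=> /e_convex_setP sep gNy p pg; apply: contrapT => np.
have [z gz] : epi g !=set0.
  apply/set0P/eqP => g0.
  suff /epi_affine_of[] : epi (affine_of (0%R, 0%R, 0%R, 0%R)) p.
    by rewrite /= ltxx.
  by apply: pg; rewrite g0.
have [r gr] : exists r : R, g z.1 = r%:E.
  by move: gz (gNy z.1); rewrite /epi /=; case: (g z.1) => // r; exists r.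
have [u1 u1g] : exists u1 : topdual (X * R^o)%type,
    forall p', epi g p' -> (u1 p' < u1 (z.1, r - 1))%R.
  by apply: sep; rewrite /epi /= gr lee_fin; lra.
have s1 : (u1 (0, 1)%R < 0)%R.
  have := u1g (z.1, r); rewrite /epi /= gr lexx => /(_ isT).
  by rewrite (topdual_prodE u1 (_, r)) (topdual_prodE u1 (_, r - 1)%R) /=; lra.
have [q1 q1g] : exists q1, dual_polar (epi g) q1.
  by eexists; exact: nonvertical_minorant s1 u1g.
(* The separating half-space may pass through the excluded point, so this point
   is chosen strictly above p in order to have p strictly below the minorant. *)
have [t [pt nt]] : exists t, (p.2 < t)%R /\ ~ epi g (p.1, t).
  move: np (gNy p.1); rewrite /epi /=; case: (g p.1) => [b| |]//.
    rewrite lee_fin => /negP; rewrite -ltNge => pb _.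
    by exists ((p.2 + b) / 2)%R; rewrite lee_fin; split; [lra|apply/negP; lra].
  by move=> _ _; exists (p.2 + 1)%R; split; [lra|rewrite leye_eq].
have [u ug] := sep _ nt.
have [s0|s0|s0] := ltgtP (u (0, 1)%R) 0%R.
- have /pg/epi_affine_of[_ /=] := nonvertical_minorant s0 ug; lra.
- (* An upward normal is impossible: (z.1, b) is in the epigraph, but b is
     high enough for it to leave the half-space. *)
  pose b := (r + `|u (p.1, t) - u (z.1, r)| / u (0, 1))%R.
  have : epi g (z.1, b).
    by rewrite /epi /= gr lee_fin lerDl divr_ge0// ltW.
  move=> /ug; rewrite (topdual_prodE u (z.1, b)) /= mulrDl divfK ?gt_eqF//.
  have := ler_norm (u (p.1, t) - u (z.1, r))%R.
  rewrite (topdual_prodE u (z.1, r)) /=; lra.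
- have : dual_polar (epi g) (q1.1.1.1, fst_dual u, fst_dual u p.1 : R, q1.2).
    move=> p' gp'; have [_ p'q1] := (epi_affine_of _ _).1 (q1g _ gp').
    apply/epi_affine_of; split=> //=.
    have := ug _ gp'; rewrite (topdual_prodE u p') (topdual_prodE u (_, t)).
    by rewrite s0 !mulr0 !addr0.
  by move=> /pg/epi_affine_of[]; rewrite /= ltxx.
Qed.

(** The hypothesis excludes functions such as -oo on an e-convex set and +oo
    elsewhere: these are e-convex without having any e-affine minorant. *)
Lemma epi_econv g :
  (forall x, econv g x = -oo -> forall z, econv g z = -oo) ->
  epi (econv g) = primal_polar (dual_polar (epi g)).
Proof.
rewrite -dual_polar_econv => gNy; apply/seteqP; split; first by move=> p gp q; apply.
have [[x /gNy gy]|/forallNP gy] := pselect (exists x, econv g x = -oo).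
  by move=> p _; rewrite /epi /= gy leNye.
by apply: e_convex_bipolar; [exact: e_convex_econv|move=> x; exact/eqP/gy].
Qed.

Lemma epi_econv_additive f1 f2 : additivity_condition f1 f2 ->
  epi (econv (fun x => f1 x + f2 x)) =
  primal_polar (minkowski_sum (epi (c_conj f1)) (epi (c_conj f2))).
Proof.
move=> [_ _ add]; rewrite !epi_c_conj; apply/seteqP; split=> p; rewrite /epi /= add.
  move=> pb _ [q1 q1f] [q2 q2f] <-; apply: le_trans pb.
  apply: ereal_sup_ubound; exists (affine_of (q1 + q2)%R) => //.
  exists q1.1.1.1, q1.1.1.2, q2.1.1.1, q2.1.1.2, q1.1.2, q1.2, q2.1.2, q2.2.
  split=> //; (split; last exact/epi_subset).
    by exists q1.1.1.1, q1.1.1.2, q1.1.2, q1.2.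
  by exists q2.1.1.1, q2.1.1.2, q2.1.2, q2.2.
move=> pD; apply: ge_ereal_sup => _ [a [u1 [v1 [u2 [v2 [al1 [be1 [al2 [be2 aE]]]]]]]] <-].
have [[_ a1f] [_ a2f] ->] := aE.
apply: (pD (u1 + u2, v1 + v2, al1 + al2, be1 + be2)%R).
exists (u1, v1, al1, be1); first exact/epi_subset.
by exists (u2, v2, al2, be2) => //; exact/epi_subset.
Qed.

(** The conjugate of a sum is the e'-convex hull of the sum of the conjugates, at
    the level of epigraphs. *)
Lemma epi_c_conjD f1 f2 : additivity_condition f1 f2 ->
  epi (c_conj (fun x => f1 x + f2 x)) = dual_polar
    (primal_polar (minkowski_sum (epi (c_conj f1)) (epi (c_conj f2)))).
Proof.
by move=> add; rewrite -epi_econv_additive// epi_c_conj -dual_polar_econv.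
Qed.

Lemma c_conjNy g x w : g x < +oo -> c_conj g w != -oo.
Proof.
move=> gx; apply/eqP => gw.
have: coupling x w - g x <= c_conj g w by apply: ereal_sup_ubound; exists x.
rewrite gw /coupling; case: (g x) gx => [r| |]//= _; case: ifP => //.
Qed.

Lemma fenchel_young g w (t b : R) x :
  epi (c_conj g) (w, t) -> g x <= b%:E ->
  (w.1.2 x < w.2)%R /\ (w.1.1 x <= b + t)%R.
Proof.
by rewrite epi_c_conj => gw gx; apply: (epi_affine_of (x, b) (w, t)).1; exact: gw.
Qed.

(** The condition that c(x, w) be finite, explicit in the subdifferential, is
    implicit in the conjugate, which is +oo when c(., w) is +oo at a point where
    g is finite. *)
Lemma c_subdiffP g x (r eps : R) w : g x = r%:E ->
  c_subdiff eps g x w <-> epi (c_conj g) (w, (w.1.1 x + eps - r)%R).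
Proof.
move=> gx; split=> [[_ wx sub]|gw].
  apply: ge_ereal_sup => _ [z _ <-] /=; move: (sub z).
  rewrite gx [coupling x w]/coupling wx.
  case: (coupling z w) (g z) => [a| |] [y| |] //=; rewrite ?leey ?leNye// !lee_fin.
  lra.
have gxr : g x <= r%:E by rewrite gx.
have [wx _] := fenchel_young gw gxr.
split=> [|//|z]; first by rewrite gx.
have : coupling z w - g z <= (w.1.1 x + eps - r)%:E.
  by apply: le_trans gw; apply: ereal_sup_ubound; exists z.
rewrite gx [coupling x w]/coupling wx.
case: (coupling z w) (g z) => [a| |] [y| |] //=; rewrite ?leey ?leNye// !lee_fin.
lra.
Qed.
End Polarity.

(** * The constraint system *)

Section ConstraintSystem.
Context {R : realType} {X : tvsType R} {T : choiceType} (h : T -> X -> \bar R).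
Set Implicit Arguments.
Unset Strict Implicit.
Implicit Types (lam : fsupp R T) (s : R).

Definition fsupp_scale s lam : fsupp R T :=
  [fsfun t in finsupp lam => (s * lam t)%R].

Lemma fsupp_scaleE s lam t : fsupp_scale s lam t = (s * lam t)%R.
Proof. by rewrite fsfunE; case: finsuppP; rewrite ?mulr0. Qed.

Lemma finsupp_scale s lam : (0 < s)%R -> finsupp (fsupp_scale s lam) = finsupp lam.
Proof.
move=> s0; apply/fsetP => t; rewrite !mem_finsupp fsupp_scaleE mulf_eq0.
by rewrite gt_eqF.
Qed.

(** A positive factor distributes over every sum, the indeterminate ones
    included. *)
Lemma mule_gt0Dr s (x y : \bar R) : (0 < s)%R ->
  s%:E * (x + y) = s%:E * x + s%:E * y.
Proof.
move=> s0; case: x y => [x| |] [y| |] //=;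
  by rewrite ?gt0_muley ?gt0_muleNy ?lte_fin// -?EFinM -?EFinD ?mulrDr//
    ?addey ?addye ?addeNy ?addNye.
Qed.

Lemma wsum_scale s lam x : (0 < s)%R ->
  wsum (fsupp_scale s lam) h x = s%:E * wsum lam h x.
Proof.
move=> s0; rewrite /wsum finsupp_scale//.
elim: (enum_fset _) => [|t r IH]; first by rewrite !big_nil mule0.
by rewrite !big_cons IH mule_gt0Dr// fsupp_scaleE EFinM muleA.
Qed.

(** Scaling lambda h by s scales the minorants, but not their domains: the
    cutting half-space v < al is kept. *)
Lemma epi_c_conj_wsum_scale s lam (u v : topdual X) (al b : R) : (0 < s)%R ->
  epi (c_conj (wsum lam h)) (u, v, al, b) ->
  epi (c_conj (wsum (fsupp_scale s lam) h)) ((s *: u)%R, v, al, (s * b)%R).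
Proof.
move=> s0; rewrite !epi_c_conj => /epi_subset lamh; apply/epi_subset => x.
rewrite wsum_scale//; apply: (@le_trans _ _ (s%:E * affine_of (u, v, al, b) x)).
  rewrite /affine_of /e_affine /=; case: ifP => _; last first.
    by rewrite gt0_muley ?lte_fin.
  by rewrite -EFinM lee_fin mulrBr.
by rewrite lee_pmul2l// lte_fin.
Qed.

(** If (x, b) is polar to K, then the affine part of a minorant of lambda h has
    all its positive multiples bounded by b at x, so that it is nonpositive
    there; hence econv (lambda h) x <= 0.  The choice lambda = 0 contributes the
    inequality 0 <= b. *)
Lemma primal_polar_moment_set :
  (forall lam, fsupp_ge0 R T lam ->
     forall x, econv (wsum lam h) x = -oo ->
     forall z, econv (wsum lam h) z = -oo) ->
  primal_polar (moment_set h) = epi (delta_fun (econv_feasible h)).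
Proof.
move=> hNy; apply/seteqP; split=> [[x b] xb|[x b]].
  have b0 : (0 <= b)%R.
    have : moment_set h (0%R, 0%R, 1%R, 0%R).
      exists [fsfun]; first by move=> t; rewrite /= fsfunE.
      rewrite epi_c_conj; apply/epi_subset => z.
      by rewrite /wsum finsupp0 big_nil /affine_of /e_affine /= ltr01 subr0.
    by move=> /xb/epi_affine_of[_ /=]; rewrite addr0.
  suff xB : econv_feasible h x by rewrite /epi /delta_fun /= mem_set.
  move=> lam lam0.
  suff : epi (econv (wsum lam h)) (x, 0%R) by [].
  rewrite (epi_econv (hNy _ lam0)) -epi_c_conj => -[[[u v] al] t] lamut.
  have Kst s : (0 < s)%R -> moment_set h ((s *: u)%R, v, al, (s * t)%R).
    move=> s0; exists (fsupp_scale s lam); last exact: epi_c_conj_wsum_scale.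
    by move=> t' /=; rewrite fsupp_scaleE mulr_ge0// ?ltW// lam0.
  apply/epi_affine_of; split=> /=.
    by have /Kst/xb/epi_affine_of[] := @ltr01 R.
  rewrite add0r leNgt; apply/negP => tu.
  have d0 : (0 < u x - t)%R by rewrite subr_gt0.
  (* This multiple of u - t takes the value b + 1 at x. *)
  pose s := ((b + 1) / (u x - t))%R.
  have s0 : (0 < s)%R by rewrite divr_gt0// ltr_pwDr.
  have : (s * u x <= b + s * t)%R by have /Kst/xb/epi_affine_of[] := s0.
  rewrite -lerBlDr -mulrBr.
  rewrite /s divfK ?gt_eqF//; lra.
rewrite /epi /delta_fun /=; case: ifPn => // /set_mem xB; rewrite lee_fin => b0.
move=> q [lam lam0]; rewrite epi_c_conj -dual_polar_econv => /epi_subset qlam.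
by apply: le_trans (qlam x) _; apply: (le_trans (xB _ lam0)); rewrite lee_fin.
Qed.

Lemma moment_set_eq :
  e'_convex_set (moment_set h) ->
  (forall lam, fsupp_ge0 R T lam ->
     forall x, econv (wsum lam h) x = -oo ->
     forall z, econv (wsum lam h) z = -oo) ->
  moment_set h = epi (c_conj (delta_fun (econv_feasible h))).
Proof.
move=> /e'_convex_setP K hNy.
by rewrite K primal_polar_moment_set// epi_c_conj.
Qed.

End ConstraintSystem.

(** * Exactness of the three formulas *)

(** Both sides say that a real r is at least G v if and only if v and r split as
    v = v1 + v2 and r = r1 + r2 with F v1 <= r1 and k i v2 <= r2 for some i in
    L.  Excluding -oo makes a finite sum of values split into finite terms; at
    the points where G is +oo, the infimum is attained as soon as L is
    nonempty. *)
Lemma exact_inf_convolutionP {R : realType} {V : zmodType} {I : Type}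
    (L : set I) (F G : V -> \bar R) (k : I -> V -> \bar R) :
  L !=set0 -> (forall v, F v != -oo) ->
  (forall i, L i -> forall v, k i v != -oo) -> (forall v, G v != -oo) ->
  (forall v, is_min [set F p.2 + k p.1 (v - p.2)%R | p in L `*` [set: V]] (G v))
  <-> minkowski_sum (epi F) (\bigcup_(i in L) epi (k i)) = epi G.
Proof.
move=> [i0 Li0] FNy kNy GNy.
have finite_terms i v1 v2 (r : R) : L i -> F v1 + k i v2 <= r%:E ->
    exists a b, [/\ F v1 = a%:E, k i v2 = b%:E & (a + b <= r)%R].
  move=> Li; move: (FNy v1) (kNy _ Li v2).
  case: (F v1) (k i v2) => [a| |] [b| |]// _ _.
  by rewrite -EFinD lee_fin => abr; exists a, b.
split=> [minG|sumG v].
  apply/seteqP; split=> [_ [[v1 r1] Fr1] [[v2 r2] [i Li kr2]] <-|[v r] Gr].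
    have [_ lbG] := minG (v1 + v2)%R; rewrite /epi /=.
    apply: (@le_trans _ _ (F v1 + k i v2)); last by rewrite EFinD leeD.
    by apply: lbG; exists (i, v1) => //=; rewrite (addrC v1) addrK.
  have [[[i v1] [/= Li _] Gv] _] := minG v.
  have /(finite_terms _ _ _ _ Li)[a [b [Fa kb abr]]] : F v1 + k i (v - v1)%R <= r%:E.
    by rewrite Gv.
  exists (v1, a); first by rewrite /epi /= Fa.
  exists ((v - v1)%R, (r - a)%R).
    by exists i => //; rewrite /epi /= kb lee_fin lerBrDl.
  by congr (_, _); exact: subrKC.
have lbG : lbound [set F p.2 + k p.1 (v - p.2)%R | p in L `*` [set: V]] (G v).
  move=> _ [[i v1] [/= Li _] <-].
  case E : (F v1 + k i (v - v1)%R) => [r| |]; last 2 first.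
  - by rewrite leey.
  - by have := E; move: (FNy v1) (kNy _ Li (v - v1)%R); case: (F v1) (k i _) => [?| |] [?| |].
  have /(finite_terms _ _ _ _ Li)[a [b [Fa kb abr]]] : F v1 + k i (v - v1)%R <= r%:E.
    by rewrite E.
  suff : epi G (v, r) by [].
  rewrite -sumG; exists (v1, a); first by rewrite /epi /= Fa.
  exists ((v - v1)%R, (r - a)%R).
    by exists i => //; rewrite /epi /= kb lee_fin lerBrDl.
  by congr (_, _); exact: subrKC.
split=> //.
case E : (G v) => [r| |]; last by have := GNy v; rewrite E.
  have : epi G (v, r) by rewrite /epi /= E.
  rewrite -sumG => -[[v1 r1] Fr1 [[v2 r2] [i Li kr2] [v12 r12]]].
  exists (i, v1) => //=; apply/le_anti/andP; split; last first.
    by rewrite -E; apply: lbG; exists (i, v1).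
  by rewrite -v12 (addrC v1) addrK -r12 EFinD leeD.
exists (i0, 0%R) => //=; apply/eqP; rewrite -leye_eq -E.
by apply: lbG; exists (i0, 0%R).
Qed.

Lemma W_addE {R : realType} {X : tvsType R} (w1 w2 : W X) (x : X) :
  ((w1 + w2)%R.1.1 x = w1.1.1 x + w2.1.1 x)%R.
Proof. by []. Qed.

(** The change of variables is r1 = <x, w1> + eps1 - f x and
    r2 = <x, w2> + eps2 - econv g x, with f x = r; the Fenchel-Young
    inequality turns r1 and r2 into nonnegative eps1 and eps2. *)
Lemma c_subdiff_sum {R : realType} {X : tvsType R} {f g : X -> \bar R}
    {x : X} {r : R} (eps : R) (w : W X) :
  f x = r%:E -> econv g x < +oo ->
  (\bigcup_(e in [set e : R * R | [/\ (0 <= e.1)%R, (0 <= e.2)%R &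
                   (e.1 + e.2)%:E = eps%:E + econv g x]])
     minkowski_sum (c_subdiff e.1 f x) (c_subdiff e.2 (econv g) x)) w
  <-> minkowski_sum (epi (c_conj f)) (epi (c_conj g)) (w, (w.1.1 x + eps - r)%R).
Proof.
move=> fx gx; split.
  move=> [[e1 e2] /= [_ _ e12]] [w1 /(c_subdiffP _ _ fx) w1f] [w2 w2g] <-.
  have [gfin _ _] := w2g; move: (fineK gfin) => /esym gs.
  move: w2g => /(c_subdiffP _ _ gs); rewrite c_conj_econv => w2g.
  exists (w1, (w1.1.1 x + e1 - r)%R) => //.
  exists (w2, (w2.1.1 x + e2 - fine (econv g x))%R) => //.
  have := W_addE w1 w2 x; set wx := (w1 + w2)%R.1.1 x => wxE.
  congr (_, _); move: e12; rewrite gs -EFinD => -[] /=.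
  by rewrite wxE; lra.
move=> [[w1 t1] w1f [[w2 t2] w2g [w12 t12]]].
have w2g' : epi (c_conj (econv g)) (w2, t2) by rewrite c_conj_econv.
have [s gs] : exists s : R, econv g x = s%:E.
  case E : (econv g x) gx => [s| |]// _; first by exists s.
  have gb (b : R) : econv g x <= b%:E by rewrite E leNye.
  have [_] := fenchel_young w2g' (gb (w2.1.1 x - t2 - 1)%R); lra.
have fr : f x <= r%:E by rewrite fx.
have gsle : econv g x <= s%:E by rewrite gs.
have [_ /= fy1] := fenchel_young w1f fr.
have [_ /= fy2] := fenchel_young w2g' gsle.
exists (t1 - w1.1.1 x + r, t2 - w2.1.1 x + s)%R.
  split=> /=; [lra|lra|rewrite gs -EFinD; congr (_%:E)].
  have wx : (w.1.1 x = w1.1.1 x + w2.1.1 x)%R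
    by rewrite -w12; exact: W_addE.
  by move: t12 => /=; rewrite wx; lra.
exists w1 => /=.
  apply/(c_subdiffP _ _ fx).
  by rewrite (_ : _ - r = t1)%R//; lra.
exists w2 => //; apply/(c_subdiffP _ _ gs); rewrite c_conj_econv.
by rewrite (_ : _ - s = t2)%R//; lra.
Qed.

Theorem theorem5p1 (R : realType) (X : tvsType R)
    (X_hausdorff : hausdorff_space X)
    (X_nontrivial : exists x : X, x != 0%R)
    (X_weak : has_weak_topology X)
    (T : choiceType) (f : X -> \bar R) (h : T -> X -> \bar R)
    (f_proper : proper_fun f) (f_convex : convex_fun f)
    (h_proper : forall t, proper_fun (h t)) (h_convex : forall t, convex_fun (h t))
    (fh_additive : additivity_condition f (delta_fun (econv_feasible h)))
    (K_convex : e'_convex_set (moment_set h))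
    (* Without [feasible] (iii) is vacuous and (ii) fails, as for X = R, f the
       indicator of {1} and a single h, the indicator of {0}.  Without
       [econv_h], the moment set K can be e'-convex and yet carry less
       information than the feasible set. *)
    (feasible : econv_feasible h `&` edom f !=set0)
    (econv_h : forall lam, fsupp_ge0 R T lam ->
       forall x, econv (wsum lam h) x = -oo ->
       forall z, econv (wsum lam h) z = -oo) :
  let fB := fun x => f x + delta_fun (econv_feasible h) x in
  let i := e'_convex_set (minkowski_sum (epi (c_conj f)) (moment_set h)) in
  let ii := forall w : W X,
    is_min [set c_conj f p.2 + c_conj (wsum p.1 h) (w - p.2)%R
           | p in fsupp_ge0 R T `*` [set: W X]]
      (c_conj fB w) in
  let iii := forall xbar, (econv_feasible h `&` edom f) xbar ->
    forall eps : R, (0 <= eps)%R ->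
    c_subdiff eps fB xbar =
    \bigcup_(lam in fsupp_ge0 R T)
      \bigcup_(e in [set e : R * R | [/\ (0 <= e.1)%R, (0 <= e.2)%R &
                 (e.1 + e.2)%:E = eps%:E + econv (wsum lam h) xbar]])
        minkowski_sum (c_subdiff e.1 f xbar)
                  (c_subdiff e.2 (econv (wsum lam h)) xbar) in
  (i <-> ii) /\ (i <-> iii).
Proof.
move=> fB i ii iii.
have [x0 [x0B x0f]] := feasible.
have fB_eq x : econv_feasible h x -> fB x = f x.
  by move=> xB; rewrite /fB /delta_fun mem_set// adde0.
pose M := minkowski_sum (epi (c_conj f)) (moment_set h).
have fB_M : epi (c_conj fB) = dual_polar (primal_polar M).
  by rewrite /M moment_set_eq//; exact: epi_c_conjD.
have iP : i <-> M = epi (c_conj fB) by rewrite fB_M; exact: e'_convex_setP.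
have ecx lam x : fsupp_ge0 R T lam -> econv_feasible h x ->
    econv (wsum lam h) x < +oo.
  by move=> lam0 xB; apply: le_lt_trans (xB _ lam0) _; rewrite ltry.
have f_real x : edom f x -> exists r : R, f x = r%:E.
  rewrite /edom /=; have [+ _] := f_proper => /(_ x).
  by case: (f x) => // r _ _; exists r.
have iiP : ii <-> M = epi (c_conj fB).
  apply: exact_inf_convolutionP.
  - by exists [fsfun] => t; rewrite /= fsfunE.
  - by move=> w; exact: c_conjNy x0f.
  - move=> lam lam0 w; rewrite -c_conj_econv.
    by apply: (@c_conjNy _ _ _ x0); exact: ecx.
  - by move=> w; apply: (@c_conjNy _ _ _ x0); rewrite fB_eq.
(* Once (i) and (ii) are both the equality M = epi (c_conj fB), (iii) is read as
   the equality of the sections of these sets at the feasible points. *)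
split; rewrite iP; first by rewrite iiP.
have lhsE x (r eps : R) w : econv_feasible h x -> f x = r%:E ->
    c_subdiff eps fB x w <-> epi (c_conj fB) (w, (w.1.1 x + eps - r)%R).
  by move=> xB fr; apply: c_subdiffP; rewrite fB_eq.
have rhsE x (r eps : R) w : econv_feasible h x -> f x = r%:E ->
    (\bigcup_(lam in fsupp_ge0 R T)
      \bigcup_(e in [set e : R * R | [/\ (0 <= e.1)%R, (0 <= e.2)%R &
                 (e.1 + e.2)%:E = eps%:E + econv (wsum lam h) x]])
        minkowski_sum (c_subdiff e.1 f x)
                  (c_subdiff e.2 (econv (wsum lam h)) x)) w <->
    M (w, (w.1.1 x + eps - r)%R).
  move=> xB fr; split=> [[lam lam0]|[q1 q1f [q2 [lam lam0 q2h] q12]]].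
    move=> /(c_subdiff_sum _ _ fr (ecx _ _ lam0 xB))[q1 q1f [q2 q2h q12]].
    by exists q1 => //; exists q2 => //; exists lam.
  exists lam => //; apply/(c_subdiff_sum _ _ fr (ecx _ _ lam0 xB)).
  by exists q1 => //; exists q2.
split=> [ME x [xB xf] eps _|rule].
  have [r fr] := f_real _ xf; apply/seteqP; split=> w.
    by move=> /(lhsE _ _ _ _ xB fr); rewrite -ME => /(rhsE _ _ _ _ xB fr).
  by move=> /(rhsE _ _ _ _ xB fr); rewrite ME => /(lhsE _ _ _ _ xB fr).
apply/seteqP; split=> [q Mq|[w t] wt].
  by rewrite fB_M => p; apply.
have [r fr] := f_real _ x0f.
have fBr : fB x0 <= r%:E by rewrite fB_eq// fr.
have [_ fy] := fenchel_young wt fBr.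
pose eps := (t + r - w.1.1 x0)%R.
have tE : t = (w.1.1 x0 + eps - r)%R by rewrite /eps; lra.
rewrite tE; apply/(rhsE _ _ _ _ x0B fr).
rewrite -rule//; last by rewrite /eps; lra.
by apply/(lhsE _ _ _ _ x0B fr); rewrite -tE.
Qed.
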